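(* For any $n\ge 3$ and $r\in\{2,\dots,n-1\}$, $$\ell_{\max}^{\mathrm{Acyclic}}(n,r)=\frac{(n-r)(n+r-3)}{2}+1,$$ and $$\ell_{\max}^{\mathrm{Acyclic}}(n)=\ell_{\max}^{\mathrm{Acyclic}}(n,2)=\tfrac12\,(n^2-3n+4).$$
   Context: $[n]=\{1,\dots,n\}$. A digraph has no loops and no multiple edges; it is acyclic if it has no directed cycle. Digraphs are assumed connected (underlying undirected graph connected). For distinct $a,b\in[n]$, $(a\to b)$ is the transformation of $[n]$ sending $a$ to $b$ and fixing every other point; maps act on the right and products are composed from left to right. For a digraph $D$ on $[n]$, $\langle D\rangle$ is the semigroup generated by $\{(a\to b):(a,b)\in E(D)\}$. For $\alpha\in\langle D\rangle$, $\ell(D,\alpha)$ is the minimum length of a word in the generators $(a\to b)$, $(a,b)\in E(D)$, whose product is $\alpha$. The rank $\mathrm{rk}(\alpha)$ is the size of the image of $\alpha$. Put $\ell(D,r)=\max\{\ell(D,\alpha):\alpha\in\langle D\rangle,\ \mathrm{rk}(\alpha)=r\}$ and $\ell(D)=\max\{\ell(D,\alpha):\alpha\in\langle D\rangle\}$, where a maximum over the empty set is taken to be $0$. Let $\mathrm{Acyclic}_n$ be the set of all acyclic digraphs on $[n]$, and define $\ell_{\max}^{\mathrm{Acyclic}}(n,r)=\max\{\ell(A,r):A\in\mathrm{Acyclic}_n\}$ and $\ell_{\max}^{\mathrm{Acyclic}}(n)=\max\{\ell(A):A\in\mathrm{Acyclic}_n\}$. *)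

(* Defs.v *)
From mathcomp Require Import all_boot.

Set Implicit Arguments.
Unset Strict Implicit.
Unset Printing Implicit Defensive.

(* The vertex set [n] is represented by 'I_n, and a digraph on it by its set  *)
(* of arcs, which rules out multiple arcs.                                    *)
Definition arcs (n : nat) := {set 'I_n * 'I_n}.

Definition arc_rel n (D : arcs n) : rel 'I_n := fun a b => (a, b) \in D.

Definition loopless n (D : arcs n) : bool := [forall a, ~~ arc_rel D a a].

Definition connected n (D : arcs n) : bool :=
  [forall a, forall b,
    connect (fun x y => arc_rel D x y || arc_rel D y x) a b].

Definition digraph n (D : arcs n) : bool := loopless D && connected D.

(* A directed cycle visits k.+1 distinct vertices, so k < n; see acyclicP.    *)
Definition acyclic n (D : arcs n) : bool :=
  [forall k : 'I_n, forall c : k.+1.-tuple 'I_n, ~~ ucycleb (arc_rel D) c].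

Lemma acyclicP n (D : arcs n) :
  reflect (forall c : seq 'I_n, c != [::] -> ~ ucycle (arc_rel D) c)
          (acyclic D).
Proof.
apply: (iffP forallP) => [acD c c0 cycc | acD k].
  have /andP[_ uc] := cycc.
  have sc : (size c).-1.+1 = size c by case: (c) c0.
  have lt_c : (size c).-1 < n.
    by rewrite sc -[n in _ <= n]card_ord -(card_uniqP uc) max_card.
  have szc : size c == (Ordinal lt_c).+1 by rewrite /= sc.
  by have /forallP/(_ (Tuple szc))/negP := acD (Ordinal lt_c); apply.
apply/forallP => c; apply/negP; apply: acD.
by rewrite -size_eq0 size_tuple.
Qed.

Definition transf (n : nat) := {ffun 'I_n -> 'I_n}.

(* Maps act on the right: x (f g) = (x f) g.                                  *)
Definition tmul n (f g : transf n) : transf n := [ffun x => g (f x)].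

Definition arc_transf n (e : 'I_n * 'I_n) : transf n :=
  [ffun x => if x == e.1 then e.2 else x].

Definition generators n (D : arcs n) : {set transf n} :=
  [set arc_transf e | e in D].

Definition tmul_closed n (S : {set transf n}) : bool :=
  [forall f in S, forall g in S, tmul f g \in S].

Definition arc_semigroup n (D : arcs n) : {set transf n} :=
  \bigcap_(S : {set transf n} | (generators D \subset S) && tmul_closed S) S.

Definition word_prod n (w : seq ('I_n * 'I_n)) : transf n :=
  foldl (fun f e => tmul f (arc_transf e)) [ffun x => x] w.

(* Words of a semigroup are nonempty.                                         *)
Definition has_word n (D : arcs n) (f : transf n) (k : nat) : bool :=
  (0 < k) &&
  [exists w : k.-tuple ('I_n * 'I_n),
     all (fun e => e \in D) w && (word_prod w == f)].

Lemma has_wordP n (D : arcs n) (f : transf n) k :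
  reflect (exists w : seq ('I_n * 'I_n),
             [/\ 0 < k, size w = k, {subset w <= D} & word_prod w = f])
          (has_word D f k).
Proof.
apply: (iffP andP) => [[k0 /existsP[w /andP[/allP wD /eqP wf]]] | ].
  by exists w; rewrite size_tuple.
case=> w [k0 /eqP szw wD wf]; split=> //; apply/existsP.
by exists (Tuple szw); apply/andP; split; [apply/allP | apply/eqP].
Qed.

Lemma has_word_arc n (D : arcs n) e : e \in D -> has_word D (arc_transf e) 1.
Proof.
move=> eD; apply/has_wordP; exists [:: e]; split=> //.
  by move=> a; rewrite inE => /eqP->.
by apply/ffunP => x; rewrite !ffunE.
Qed.

Lemma has_word_mul_arc n (D : arcs n) f k e :
  has_word D f k -> e \in D -> has_word D (tmul f (arc_transf e)) k.+1.
Proof.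
case/has_wordP=> w [k0 <- wD <-] eD; apply/has_wordP; exists (rcons w e).
rewrite size_rcons /word_prod foldl_rcons; split=> // a.
by rewrite mem_rcons inE => /orP[/eqP->|/wD].
Qed.

Lemma arc_semigroupP n (D : arcs n) (f : transf n) :
  reflect (exists k, has_word D f k) (f \in arc_semigroup D).
Proof.
have tmulA (g h k : transf n) : tmul g (tmul h k) = tmul (tmul g h) k.
  by apply/ffunP => x; rewrite !ffunE.
apply: (iffP bigcapP) => [fS | [k /has_wordP[w [k0 szw wD <-]]] S].
  pose R (g h : transf n) := [exists e in D, h == tmul g (arc_transf e)].
  pose W := [set h | [exists e in D, connect R (arc_transf e) h]].
  have Rmul g h e : e \in D -> connect R g h ->
      connect R g (tmul h (arc_transf e)).
    move=> eD /connect_trans; apply; apply: connect1.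
    by apply/existsP; exists e; rewrite eD eqxx.
  have connW e h : connect R (arc_transf e) h -> e \in D ->
      (exists k, has_word D h k) /\ forall g, g \in W -> tmul g h \in W.
    case/connectP=> p; elim/last_ind: p h => [|p q IHp] h /=.
      move=> _ -> eD; split; first by exists 1; apply: has_word_arc.
      move=> g; rewrite !inE => /existsP[a /andP[aD ag]].
      by apply/existsP; exists a; rewrite aD Rmul.
    rewrite rcons_path last_rcons.
    move=> /andP[pp /existsP[a /andP[aD /eqP Dq]]] -> eD.
    have [[k Hk] HW] := IHp _ pp erefl eD; rewrite Dq; split.
      by exists k.+1; apply: has_word_mul_arc.
    move=> g /HW; rewrite tmulA !inE => /existsP[b /andP[bD bg]].
    by apply/existsP; exists b; rewrite bD Rmul.
  have /fS : (generators D \subset W) && tmul_closed W.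
    apply/andP; split.
      apply/subsetP => _ /imsetP[e eD ->]; rewrite inE.
      by apply/existsP; exists e; rewrite eD connect0.
    apply/forall_inP => g gW; apply/forall_inP => h.
    rewrite inE => /existsP[e /andP[eD eh]].
    by have [_] := connW _ _ eh eD; apply.
  by rewrite inE => /existsP[e /andP[eD ef]]; have [] := connW _ _ ef eD.
case/andP=> /subsetP gS /forall_inP cS.
have arcS e : e \in D -> arc_transf e \in S by move=> eD; apply/gS/imset_f.
move: k0; rewrite -{}szw {k}; elim/last_ind: w wD => [|w e IHw] // wD _.
have eD : e \in D by apply: wD; rewrite mem_rcons mem_head.
rewrite /word_prod foldl_rcons -/(word_prod w).
have [w0 | w_gt0] := posnP (size w).
  rewrite (size0nil w0) /=.
  suff -> : tmul [ffun x => x] (arc_transf e) = arc_transf e by apply: arcS.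
  by apply/ffunP => x; rewrite !ffunE.
have wS : word_prod w \in S.
  by apply: IHw => // a aw; apply: wD; rewrite mem_rcons inE aw orbT.
by have /forall_inP := cS _ wS; apply; apply: arcS.
Qed.

(* The value 0 outside of the semigroup is junk.                              *)
Definition arc_length n (D : arcs n) (f : transf n) : nat :=
  if @arc_semigroupP n D f is ReflectT ex_word then ex_minn ex_word else 0.

Lemma arc_lengthP n (D : arcs n) (f : transf n) :
  f \in arc_semigroup D ->
  has_word D f (arc_length D f) /\
  forall k, has_word D f k -> arc_length D f <= k.
Proof.
by rewrite /arc_length; case: arc_semigroupP => // ex_word _; case: ex_minnP.
Qed.

Definition rk n (f : transf n) : nat := #|f @: [set: 'I_n]|.

(* On nat, \max over the empty range is 0.                                    *)
Definition max_length_rk n (D : arcs n) (r : nat) : nat :=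
  \max_(f in arc_semigroup D | rk f == r) arc_length D f.

Definition max_length n (D : arcs n) : nat :=
  \max_(f in arc_semigroup D) arc_length D f.

Definition Acyclic (n : nat) : {set arcs n} :=
  [set D : arcs n | digraph D && acyclic D].

Definition lmax_Acyclic_rk (n r : nat) : nat :=
  \max_(D in Acyclic n) max_length_rk D r.

Definition lmax_Acyclic (n : nat) : nat :=
  \max_(D in Acyclic n) max_length D.

(* Main.v *)
Require Import Defs.
From mathcomp Require Import all_boot all_order all_algebra.
From mathcomp Require Import zify ring.

Set Implicit Arguments.
Unset Strict Implicit.
Unset Printing Implicit Defensive.

(** Write the vertices as 0, ..., n-1. The whole argument is a count of how far
the points, seen as tokens, can travel.

Upper bound. List the vertices of an acyclic digraph in a topological order, so
that every arc lowers the height. In a shortest word every arc moves some token.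
An arc whose source has height at least 2 lowers, by 1 or more, the sum over all
tokens of (height - 1), truncated at 0, and this sum starts at the sum of
(i - 1) for i < n. It cannot end below the same sum for i < r when the rank is r,
because the r image points have distinct heights [sum_rk_geq]. The remaining
arcs all coincide: only one arc can leave the vertex of height 1, namely the one down to
the vertex of height 0. It need not be used more than once, since tokens brought
down earlier may as well wait at height 1 until its last use [short_word].
Hence the length is at most 1 plus the sum of (i - 1) for r <= i < n
[arc_length_excess].

Lower bound. Take the path n-1 -> ... -> 1 -> 0 with the extra arc 2 -> 0, and
the map that fixes 0, sends the next d + 1 = n - r + 1 points alternately to 0
and 1 and shifts every other point down by d. Tokens can overtake one another
only at the bottom two vertices, and neighbouring tokens have different
destinations (except for 0 and 1), so above the bottom two vertices tokens never
merge and must be moved one at a time: each arc lowers the sum above by at most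
1 [high_arcs_geq]. The arc 1 -> 0 leaves the sum alone and is needed as well, to
bring the token 1 to 0 [alternating_length].

The correction by the image points is never negative and vanishes for r = 2,
so the bound for r = 2 holds for all maps and gives the maximum over all ranks. *)

(** * Words acting on points *)

Definition step n (x : 'I_n) (e : 'I_n * 'I_n) : 'I_n :=
  if x == e.1 then e.2 else x.

Definition run n (x : 'I_n) (w : seq ('I_n * 'I_n)) : 'I_n :=
  foldl (@step n) x w.

Lemma word_prodE n (w : seq ('I_n * 'I_n)) x : word_prod w x = run x w.
Proof.
elim/last_ind: w => [|w e IHw]; first by rewrite /word_prod /= ffunE.
by rewrite /word_prod /run !foldl_rcons !ffunE -/(word_prod w) IHw.
Qed.

(** * Topological orders of acyclic digraphs *)

Lemma acyclic_decreasing n (D : arcs n) (h : 'I_n -> nat) :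
  (forall e : 'I_n * 'I_n, e \in D -> h e.2 < h e.1) -> acyclic D.
Proof.
move=> hD; apply/acyclicP => -[|x p] // _ /andP[cyc _].
have lt_trans : transitive (fun a b => h b < h a).
  by move=> b a c ba cb; apply: ltn_trans cb ba.
have: path (fun a b => h b < h a) x (rcons p x).
  by apply: sub_path cyc => a b /hD.
move/(order_path_min lt_trans)/allP/(_ x).
by rewrite mem_rcons mem_head ltnn => /(_ isT).
Qed.

Lemma acyclic_no_return n (D : arcs n) a b :
  acyclic D -> (a, b) \in D -> ~~ connect (arc_rel D) b a.
Proof.
move=> /acyclicP acD abD; apply/negP => /connectP[p0 path0 last0].
case: (shortenP path0) last0 => p path_p uniq_p _ Da.
apply: (acD (b :: p)) => //; apply/andP; split=> //=.
by rewrite rcons_path path_p -Da.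
Qed.

(** The number of descendants already decreases strictly along arcs; sorting the
vertices by it breaks the ties, which makes the height injective. *)
Lemma topological_height n (D : arcs n) : acyclic D ->
  exists2 h : 'I_n -> 'I_n, injective h
    & forall e : 'I_n * 'I_n, e \in D -> h e.2 < h e.1.
Proof.
move=> acD; pose c x := #|connect (arc_rel D) x|.
have cD a b : (a, b) \in D -> c b < c a.
  move=> abD; apply/proper_card/properP; split.
    by apply/subsetP => y; apply: connect_trans; apply: connect1.
  by exists a; [apply: connect0 | apply: acyclic_no_return].
pose le_c x y := c x <= c y.
pose s := sort le_c (enum 'I_n).
have s_all x : x \in s by rewrite mem_sort mem_enum.
have lt_s x : index x s < n.
  by have := s_all x; rewrite -index_mem size_sort -cardE card_ord.
have le_c_trans : transitive le_c by move=> y x z; apply: leq_trans.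
have s_sorted : sorted le_c s by apply: sort_sorted => x y; apply: leq_total.
exists (fun x => Ordinal (lt_s x)) => [x y [] |[a b] /cD lt_ba /=].
  by move/(congr1 (nth x s)); rewrite !nth_index.
rewrite ltnNge; apply/negP => le_ab.
have := sorted_leq_index le_c_trans (fun x => leqnn (c x)) s_sorted.
by move/(_ a b (s_all a) (s_all b) le_ab); rewrite /le_c leqNgt lt_ba.
Qed.

(** * Sums over distinct heights *)

(** Among k + 1 distinct naturals one is at least k; remove it and recurse. *)
Lemma sum_distinct_geq (F : nat -> nat) (s : seq nat) :
  {homo F : i j / i <= j} -> uniq s ->
  \sum_(i < size s) F i <= \sum_(i <- s) F i.
Proof.
move=> monoF; move Dk: (size s) => k; elim: k s Dk => [|k IHk] s Dk uniq_s.
  by rewrite big_ord0.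
have [x xs le_kx] : exists2 x, x \in s & k <= x.
  apply/hasP; rewrite -[has _ _]negbK -all_predC; apply/negP => /allP small.
  have sub_s : {subset s <= iota 0 k}.
    by move=> x /small /=; rewrite mem_iota /= -ltnNge.
  by have := uniq_leq_size uniq_s sub_s; rewrite Dk size_iota ltnn.
rewrite big_ord_recr (perm_big _ (perm_to_rem xs)) big_cons /= [leqRHS]addnC.
by rewrite leq_add ?monoF ?IHk ?rem_uniq // size_rem // Dk.
Qed.

(** Keep one point over each image point: the remaining heights are distinct. *)
Lemma sum_rk_geq n (F : nat -> nat) (h : 'I_n -> 'I_n) (f : transf n) :
  {homo F : i j / i <= j} -> injective h ->
  \sum_(i < rk f) F i <= \sum_v F (h (f v)).
Proof.
move=> monoF inj_h; pose s := [seq val (h y) | y <- enum (f @: [set: 'I_n])].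
have uniq_s : uniq s.
  by rewrite map_inj_uniq ?enum_uniq // => x y /= /ord_inj/inj_h.
have := sum_distinct_geq monoF uniq_s; rewrite size_map -cardE -/(rk f).
move/leq_trans; apply; rewrite big_map big_enum /=.
have -> : \sum_v F (h (f v)) = \sum_(v in [set: 'I_n]) F (h (f v)).
  by apply: eq_bigl => v; rewrite inE.
rewrite [leqRHS](partition_big_imset f) /=; apply: leq_sum => _ /imsetP[v _ ->].
by rewrite (bigD1 v) ?inE ?eqxx //= leq_addr.
Qed.

(** * The upper bound *)

Section UpperBound.

Variables (n : nat) (D : arcs n) (h : 'I_n -> 'I_n).
Hypothesis inj_h : injective h.
Hypothesis hD : forall e : 'I_n * 'I_n, e \in D -> h e.2 < h e.1.

Definition bottom_arc (e : 'I_n * 'I_n) := h e.1 == 1 :> nat.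

(** A bound on the moves that the tokens, standing at the points g v, can still
make from vertices of height at least 2: each lowers the height. *)
Definition excess (g : 'I_n -> 'I_n) := \sum_v (h (g v)).-1.

(** A token waiting at height 1 can only be moved by e, and it ends where e
would have put it earlier, since no arc leaves height 0. *)
Lemma run_bottom (e : 'I_n * 'I_n) (w : seq ('I_n * 'I_n)) :
  e \in D -> bottom_arc e -> {subset w <= D} -> e \in w ->
  run e.1 w = run e.2 w.
Proof.
move=> eD /eqP e1 + ew.
have e2 : h e.2 = 0 :> nat by have := hD eD; rewrite e1; lia.
have fix2 u : {subset u <= D} -> run e.2 u = e.2.
  elim: u => //= a u IHu aD; rewrite /step; case: eqP => [De|_].
    by have := hD (aD a (mem_head _ _)); rewrite -De e2.
  by apply: IHu => b bu; apply: aD; rewrite inE bu orbT.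
elim: w ew => //= a w IHw; rewrite inE => ew aD.
have wD : {subset w <= D} by move=> b bw; apply: aD; rewrite inE bw orbT.
have aiD := aD a (mem_head _ _).
have -> : step e.2 a = e.2 by apply: (fix2 [:: a]) => b; rewrite inE => /eqP->.
rewrite /step; case: eqP => [De|ne]; last first.
  apply: IHw => //; case/orP: ew => // /eqP De; by rewrite De in ne.
congr (run _ w); apply/inj_h/ord_inj; rewrite /= e2.
by have := hD aiD; rewrite -De e1 ltnS leqn0 => /eqP.
Qed.

Lemma bottom_arc_unique (e e' : 'I_n * 'I_n) : e \in D -> e' \in D ->
  bottom_arc e -> bottom_arc e' -> e = e'.
Proof.
case: e e' => [a b] [a' b'] /hD /= hb /hD /= hb' /eqP/= ha /eqP/= ha'.
by congr pair; apply/inj_h/ord_inj => /=; lia.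
Qed.

(** Prune the word from its end. The bottom arc is dropped when it is used again
later, by [run_bottom]; so is any other arc that moves no token. An arc that is
kept either lowers the excess or is the single use of the bottom arc that the
boolean on the right accounts for. *)
Lemma short_word (w : seq ('I_n * 'I_n)) (g : 'I_n -> 'I_n) : {subset w <= D} ->
  exists w' : seq ('I_n * 'I_n),
    [/\ {subset w' <= D}, forall v, run (g v) w' = run (g v) w
    & size w' + excess (fun v => run (g v) w) <= excess g + has bottom_arc w'].
Proof.
elim: w g => [|e w IHw] g wD.
  by exists [::]; split=> //=; rewrite addn0 add0n.
have eD : e \in D by apply: wD; rewrite mem_head.
have {}wD : {subset w <= D} by move=> a aw; apply: wD; rewrite inE aw orbT.
have [w' [w'D run_w' size_w']] := IHw (fun v => step (g v) e) wD.
have ew'D : {subset e :: w' <= D} by move=> a; rewrite inE => /orP[/eqP->|/w'D].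
have le_step v : (h (step (g v) e)).-1 <= (h (g v)).-1.
  by rewrite /step; case: eqP => // ->; have := hD eD; lia.
have le_excess : excess (fun v => step (g v) e) <= excess g.
  by apply: leq_sum => v _.
have [bot_e|high_e] := boolP (bottom_arc e).
  have [/hasP[a aw' bot_a]|no_bot] := boolP (has bottom_arc w').
    have ew' : e \in w'.
      by rewrite (bottom_arc_unique eD (w'D a aw') bot_e bot_a).
    exists w'; split=> // [v|]; last first.
      by apply: leq_trans size_w' _; rewrite leq_add2r.
    rewrite [RHS]/= -run_w' /step; case: eqP => // ->.
    exact: run_bottom.
  exists (e :: w'); split=> //.
  move: size_w'; rewrite /= bot_e (negbTE no_bot) /=.
  by rewrite /excess /= in le_excess *; lia.
have [/existsP[v0 /eqP v0e]|idle] := boolP [exists v, g v == e.1].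
  exists (e :: w'); split=> //.
  have: excess (fun v => step (g v) e) < excess g.
    rewrite /excess (bigD1 v0) //= [ltnRHS](bigD1 v0) //= -addSn leq_add //.
      have := hD eD; rewrite v0e /step eqxx; move: high_e; rewrite /bottom_arc.
      lia.
    exact: leq_sum.
  move: size_w'; rewrite /= (negbTE high_e) /excess /=; lia.
have idle_step v : step (g v) e = g v.
  by rewrite /step ifN //; apply: contra idle => ve; apply/existsP; exists v.
exists w'; split=> // [v|]; first by rewrite /= -run_w' idle_step.
by apply: leq_trans size_w' _; rewrite leq_add2r.
Qed.

End UpperBound.

Lemma leq_pred_homo : {homo predn : i j / i <= j}.
Proof. by move=> i j; lia. Qed.

Lemma arc_length_excess n (D : arcs n) (f : transf n) :
  acyclic D -> f \in arc_semigroup D ->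
  arc_length D f + \sum_(i < rk f) i.-1 <= (\sum_(i < n) i.-1).+1.
Proof.
move=> acD fD; have [h inj_h hD] := topological_height acD.
have [/has_wordP[w [w_gt0 size_w wD prod_w]] min_f] := arc_lengthP fD.
have [w' [w'D run_w' size_w']] := short_word inj_h hD id wD.
have prod_w' : word_prod w' = f.
  by rewrite -prod_w; apply/ffunP => v; rewrite !word_prodE run_w'.
have w'_gt0 : 0 < size w'.
  (* The first arc of w already identifies its two ends. *)
  rewrite lt0n; apply/negP => /nilP w'0; rewrite w'0 /= in run_w'.
  case: w wD run_w' size_w {size_w' prod_w} => [|[a b] w] wD run_w size_w.
    by rewrite -size_w in w_gt0.
  have /hD /= := wD _ (mem_head _ _); have := run_w a.
  have := run_w b; rewrite /= /step eqxx /=; case: eqP => [->|_ <- <-];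
    by rewrite ltnn.
have /min_f le_f : has_word D f (size w') by apply/has_wordP; exists w'.
have := sum_rk_geq (F := predn) f leq_pred_homo inj_h.
have <- : excess h (fun v => run v w) = \sum_v (h (f v)).-1.
  by apply: eq_bigr => v _; rewrite -prod_w word_prodE.
have <- : excess h id = \sum_(i < n) i.-1.
  by rewrite (reindex_inj inj_h).
by move: size_w'; case: has => /=; lia.
Qed.

(** * A map that needs a long word *)

Section LowerBound.

Variables n d : nat.
Hypotheses (d_gt0 : 0 < d) (lt_dn : d.+1 < n).

Definition fork_arcs : arcs n :=
  [set e : 'I_n * 'I_n |
    (e.1 == e.2.+1 :> nat) || (e.1 == 2 :> nat) && (e.2 == 0 :> nat)].

(** Here d stands for n - r. The points 0 and 1 share the value 0, which forces
one use of the arc from 1 to 0; from 1 on, consecutive values differ. *)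
Definition alternating_value v :=
  if v == 0 then 0 else if v < d.+2 then ~~ odd v : nat else v - d.

Lemma alternating_valueP v :
  v = 0 /\ alternating_value v = 0 \/
  0 < v < d.+2 /\ alternating_value v = ~~ odd v \/
  d.+2 <= v /\ alternating_value v = v - d.
Proof.
rewrite /alternating_value; case: eqP => [|/eqP]; first by left.
by rewrite -lt0n => v_gt0; right; case: (ltnP v); [left; rewrite v_gt0 | right].
Qed.

Lemma alternating_value_lt (v : 'I_n) : alternating_value v < n.
Proof.
by have := ltn_ord v; have := alternating_valueP v; lia.
Qed.

Definition alternating : transf n :=
  [ffun v => Ordinal (alternating_value_lt v)].

Lemma fork_arcsP (e : 'I_n * 'I_n) : e \in fork_arcs ->
  e.1 = e.2.+1 :> nat \/ e.1 = 2 :> nat /\ e.2 = 0 :> nat.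
Proof. by rewrite inE => /orP[/eqP|/andP[/eqP ? /eqP ?]]; [left | right]. Qed.

Lemma fork_arcs_decreasing (e : 'I_n * 'I_n) : e \in fork_arcs -> e.2 < e.1.
Proof. by move/fork_arcsP; lia. Qed.

Lemma fork_Acyclic : fork_arcs \in Acyclic n.
Proof.
have dec := fork_arcs_decreasing.
rewrite inE (acyclic_decreasing (h := val) dec) andbT; apply/andP; split.
  by apply/forallP => a; apply/negP => /dec; rewrite ltnn.
pose r x y := arc_rel fork_arcs x y || arc_rel fork_arcs y x.
have sym_r : symmetric r by move=> x y; rewrite /r orbC.
have n_gt0 : 0 < n by lia.
have to0 k (lt_kn : k < n) : connect r (Ordinal lt_kn) (Ordinal n_gt0).
  elim: k lt_kn => [|k IHk] lt_kn.
    by rewrite (bool_irrelevance lt_kn n_gt0).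
  apply: connect_trans (IHk (ltnW lt_kn)); apply: connect1.
  by rewrite /r /arc_rel inE /= eqxx.
apply/forallP => -[a lt_a]; apply/forallP => -[b lt_b].
apply: connect_trans (to0 a lt_a) _.
by rewrite (sym_connect_sym sym_r) to0.
Qed.

(** Walking down the path disturbs only the tokens at the vertices it leaves. *)
Lemma descend (a b : 'I_n) : b <= a ->
  exists w : seq ('I_n * 'I_n), [/\ {subset w <= fork_arcs}, run a w = b
    & forall x : 'I_n, (x <= b) || (a < x) -> run x w = x].
Proof.
case: a => a; elim: a => [|a IHa] lt_an le_ba.
  by exists [::]; split=> //; apply: ord_inj => /=; move: le_ba => /=; lia.
have [eq_ba | lt_ba] := eqVneq (b : nat) a.+1.
  by exists [::]; split=> //; apply: ord_inj.
have {}le_ba : b <= a by move: le_ba lt_ba => /=; lia.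
have [w [wD run_w fix_w]] := IHa (ltnW lt_an) le_ba.
exists ((Ordinal lt_an, Ordinal (ltnW lt_an)) :: w); split=> [e||x] /=.
- by rewrite inE => /orP[/eqP-> | /wD //]; rewrite inE /= eqxx.
- by rewrite /step eqxx.
rewrite /step -val_eqE /= => x_out; case: eqP => [Dx|_].
  by move: x_out; rewrite Dx; lia.
by apply: fix_w => /=; lia.
Qed.

Lemma run_cat (x : 'I_n) w1 w2 : run x (w1 ++ w2) = run (run x w1) w2.
Proof. exact: foldl_cat. Qed.

(** Send the points to their destinations in increasing order. Each walks down
the path, or down to 2 and then along the shortcut to 0, and carries along none
of the tokens already placed: when k walks down the path they are at or below
its destination, and when k takes the shortcut they are at 0 or 1. *)
Lemma alternating_word k : exists w : seq ('I_n * 'I_n),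
  {subset w <= fork_arcs} /\
  forall v : 'I_n, run v w = if v < k then alternating v else v.
Proof.
elim: k => [|k [w1 [w1D run1]]]; first by exists [::].
have [lt_kn|le_nk] := ltnP k n; last first.
  exists w1; split=> // v; rewrite run1.
  by rewrite !(leq_trans (ltn_ord v)) // leqW.
pose vk := Ordinal lt_kn.
suff [w2 [w2D run2 fix2]] : exists w2 : seq ('I_n * 'I_n), [/\
    {subset w2 <= fork_arcs}, run vk w2 = alternating vk
    & forall x : 'I_n,
        (k < x) || [exists u : 'I_n, (u < k) && (x == alternating u)] ->
        run x w2 = x].
  exists (w1 ++ w2); split=> [e|v].
    by rewrite mem_cat => /orP[/w1D|/w2D].
  rewrite run_cat run1 ltnS; case: (ltngtP v k) => [lt_vk|lt_kv|/= Dv].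
  - apply: fix2; apply/orP; right; apply/existsP; exists v.
    by rewrite lt_vk eqxx.
  - by apply: fix2; rewrite lt_kv.
  - by have -> : v = vk by apply: ord_inj.
(* Destination 0 from above 2: walking through 1 would carry along the tokens
   that have to stay there. *)
have [/andP[k_gt2 /eqP bk0] | simple] :=
    boolP ((2 < k) && (alternating_value k == 0)).
  have lt_2n : 2 < n by lia.
  have lt_0n : 0 < n by lia.
  have [w [wD run_w fix_w]] :=
    descend (a := vk) (b := Ordinal lt_2n) (ltnW k_gt2).
  exists (rcons w (Ordinal lt_2n, Ordinal lt_0n)); split=> [e||x].
  - by rewrite mem_rcons inE => /orP[/eqP->|/wD //]; rewrite inE.
  - rewrite -cats1 run_cat run_w /= /step eqxx ffunE.
    by apply: ord_inj; rewrite /= bk0.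
  move=> x_out; have x_out' : (x < 2) || (k < x).
    case/orP: x_out => [->|/existsP[u /andP[lt_uk /eqP->]]].
      by rewrite orbT.
    rewrite ffunE /=; have := alternating_valueP k.
    by have := alternating_valueP u; lia.
  rewrite -cats1 run_cat fix_w /=; last by lia.
  by rewrite /step ifN // -val_eqE /=; move: k_gt2; lia.
have le_bk : alternating vk <= vk.
  by rewrite ffunE /=; have := alternating_valueP k; lia.
have [w [wD run_w fix_w]] := descend le_bk.
exists w; split=> // x x_out; apply: fix_w.
case/orP: x_out => [->|/existsP[u /andP[lt_uk /eqP->]]]; first by rewrite orbT.
apply/orP; left; rewrite !ffunE /=.
by have := alternating_valueP k; have := alternating_valueP u; lia.
Qed.

Lemma alternating_in : alternating \in arc_semigroup fork_arcs.
Proof.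
have [w [wD run_w]] := alternating_word n.
have prod_w : word_prod w = alternating.
  by apply/ffunP => v; rewrite word_prodE run_w ltn_ord.
apply/arc_semigroupP; exists (size w); apply/has_wordP; exists w; split=> //.
rewrite lt0n; apply/negP => /nilP w0.
have lt_1n : 1 < n by lia.
have := run_w (Ordinal lt_1n); rewrite w0 ltn_ord ffunE /=.
by move/(congr1 val).
Qed.

Lemma rk_alternating : rk alternating = n - d.
Proof.
have le_nd : n - d <= n by apply: leq_subr.
have inj_w : injective (widen_ord le_nd).
  by move=> i j /(congr1 val) /= /ord_inj.
rewrite /rk -[RHS]card_ord -(card_imset 'I_(n - d) inj_w).
apply: eq_card => y; apply/imsetP/imsetP => [[v _ ->]|[i _ ->]].
  have lt_v : alternating_value v < n - d.
    by have := ltn_ord v; have := alternating_valueP v; lia.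
  by exists (Ordinal lt_v) => //; apply: ord_inj; rewrite ffunE.
have [v Dv] : exists v : 'I_n, alternating_value v = i.
  have lt_n k : k < 3 -> k < n by lia.
  case: i => -[|[|i]] lt_i /=.
  - by exists (Ordinal (lt_n 0 isT)).
  - by exists (Ordinal (lt_n 2 isT)); have /= := alternating_valueP 2; lia.
  have lt_id : i.+2 + d < n by lia.
  by exists (Ordinal lt_id) => /=; have := alternating_valueP (i.+2 + d); lia.
by exists v; rewrite ?inE //; apply: ord_inj; rewrite ffunE.
Qed.

Lemma alternating_value_neq v :
  0 < v -> alternating_value v != alternating_value v.+1.
Proof.
have := alternating_valueP v; have /= := alternating_valueP v.+1; lia.
Qed.

Definition high_arc (e : 'I_n * 'I_n) := 1 < e.1.

(** The hypotheses on g hold initially and are preserved by the arcs: above the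
bottom two vertices the tokens keep their order, and tokens never climb. If two
tokens u < v met at a vertex above the bottom, so would u and u + 1 by
monotonicity, against their distinct destinations. So an arc from such a
vertex moves at most one token, by one unit of excess. *)
Lemma high_arcs_geq (w : seq ('I_n * 'I_n)) (g : 'I_n -> 'I_n) :
  {subset w <= fork_arcs} ->
  (forall u v : 'I_n, u <= v -> g u <= maxn (g v) 1) ->
  (forall v : 'I_n, g v <= v) ->
  (forall u v : 'I_n, 0 < u -> v = u.+1 :> nat -> run (g u) w != run (g v) w) ->
  excess id g <= excess id (fun v => run (g v) w) + count high_arc w.
Proof.
elim: w g => [|e w IHw] g wD mono_g low_g sep_g; first by rewrite addn0.
have eD : e \in fork_arcs by apply: wD; rewrite mem_head.
have {}wD : {subset w <= fork_arcs}.
  by move=> a aw; apply: wD; rewrite inE aw orbT.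
have eP := fork_arcsP eD.
pose g1 v := step (g v) e.
have g1P v : g v = e.1 /\ g1 v = e.2 \/ (g v <> e.1 :> nat /\ g1 v = g v).
  by rewrite /g1 /step; case: eqP => ne; [left | right; split=> // /ord_inj].
have le_g1 v : g1 v <= g v.
  by case: (g1P v) => [[-> ->]|[_ ->]] //; lia.
have mono_g1 (u v : 'I_n) : u <= v -> g1 u <= maxn (g1 v) 1.
  move/mono_g; case: (g1P u) => [[-> ->]|[ne_u ->]];
    case: (g1P v) => [[-> ->]|[ne_v ->]]; lia.
have IHg1 := IHw g1 wD mono_g1 (fun v => leq_trans (le_g1 v) (low_g v)) sep_g.
suff le_g : excess id g <= excess id g1 + high_arc e.
  by apply: leq_trans le_g _; rewrite /= addnCA addnC leq_add2l.
have le_pred v : (g v).-1 <= (g1 v).-1 + ((g v == e.1) && high_arc e).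
  rewrite /high_arc; case: (g1P v) => [[-> ->]|[_ ->]]; rewrite ?eqxx /=; lia.
have le_sum :
    excess id g <= \sum_v ((g1 v).-1 + ((g v == e.1) && high_arc e)).
  by apply: leq_sum => v _.
apply: leq_trans le_sum _.
rewrite big_split leq_add2l /=.
have [high_e|] := boolP (high_arc e); last first.
  by rewrite big1 // => v _; rewrite andbF.
under eq_bigr => v _ do rewrite andbT.
have no_pair (u v : 'I_n) : g u = e.1 -> g v = e.1 -> ~ u < v.
  move=> gu gv lt_uv; have lt_u1 : u.+1 < n by apply: leq_ltn_trans (ltn_ord v).
  pose u1 := Ordinal lt_u1.
  have gu1 : g u1 = e.1.
    apply: ord_inj; move: high_e; rewrite /high_arc.
    have := mono_g u u1 (leqnSn u); have := mono_g u1 v lt_uv.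
    by rewrite gu gv; lia.
  have u_gt0 : 0 < u.
    by have := low_g u; rewrite gu; move: high_e; rewrite /high_arc; lia.
  by have := sep_g u u1 u_gt0 erefl; rewrite gu gu1 eqxx.
rewrite -big_mkcond /= sum1_card; apply/card_le1_eqP => u v.
move=> /eqP/ord_inj gu /eqP/ord_inj gv; apply: ord_inj.
by case: (ltngtP u v) => [/(no_pair _ _ gu gv) | /(no_pair _ _ gv gu) |].
Qed.

(** The values at most 1 contribute nothing, and neither do the truncated
differences v - d for v < d + 2, so the map may be treated as the shift by d. *)
Lemma excess_alternating : excess id alternating = \sum_(i < n - d) i.-1.
Proof.
have -> : excess id alternating = \sum_(v < n) (v - d).-1.
  apply: eq_bigr => v _; rewrite ffunE /=.
  by have := alternating_valueP v; lia.
have le_dn : d <= n by lia.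
rewrite -(big_mkord xpredT (fun v => (v - d).-1)) (big_cat_nat (n := d)) //=.
rewrite big_nat_cond big1 => [|v]; last by lia.
rewrite add0n -{1}[d]add0n big_addn big_mkord.
by apply: eq_bigr => i _; rewrite addnK.
Qed.

Lemma alternating_length :
  (\sum_(i < n) i.-1).+1 <=
    arc_length fork_arcs alternating + \sum_(i < n - d) i.-1.
Proof.
have [/has_wordP[w [_ <- wD prod_w]] _] := arc_lengthP alternating_in.
have run_w v : run v w = alternating v by rewrite -word_prodE prod_w.
have sep (u v : 'I_n) : 0 < u -> v = u.+1 :> nat -> run u w != run v w.
  move=> u_gt0 Dv; rewrite !run_w -val_eqE !ffunE /= Dv.
  exact: alternating_value_neq.
have := high_arcs_geq (g := id) wD _ (fun v => leqnn v) sep.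
have -> : excess id (fun v => run v w) = \sum_(i < n - d) i.-1.
  by rewrite -excess_alternating; apply: eq_bigr => v _; rewrite run_w.
have lt_1n : 1 < n by lia.
(* Without the arc from 1 to 0, the token 1 would never move. *)
have low_w : 0 < count (predC high_arc) w.
  rewrite -has_count; apply/negPn; rewrite -all_predC.
  apply/negP => /allP high_w.
  have fix1 u : {subset u <= w} -> run (Ordinal lt_1n) u = Ordinal lt_1n.
    elim: u => //= e u IHu ew.
    have := high_w e (ew e (mem_head _ _)).
    rewrite /= negbK /high_arc => high_e.
    rewrite /step ifN.
      by apply: IHu => a au; apply: ew; rewrite inE au orbT.
    by rewrite -val_eqE /=; lia.
  by have := run_w (Ordinal lt_1n); rewrite fix1 // ffunE => /(congr1 val).
have -> : @excess n id id = \sum_(i < n) i.-1 by [].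
rewrite -(count_predC high_arc w) => le_w.
have {}le_w := le_w (fun u v le_uv => leq_trans le_uv (leq_maxl _ _)).
by move: le_w low_w; lia.
Qed.

End LowerBound.

(** * The maxima *)

Lemma sum_pred_split n r : r <= n ->
  \sum_(i < n) i.-1 = \sum_(i < r) i.-1 + \sum_(r <= i < n) i.-1.
Proof.
by move=> le_rn; rewrite -!(big_mkord xpredT predn) (big_cat_nat (n := r)).
Qed.

Lemma lmax_Acyclic_rkE n r : 1 < r < n ->
  lmax_Acyclic_rk n r = (\sum_(r <= i < n) i.-1).+1.
Proof.
case/andP=> r_gt1 lt_rn; apply/eqP; rewrite eqn_leq; apply/andP; split.
  apply/bigmax_leqP => D; rewrite inE => /andP[_ acD].
  apply/bigmax_leqP => f /andP[fD /eqP rk_f].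
  have := arc_length_excess acD fD.
  by rewrite rk_f (sum_pred_split (ltnW lt_rn)) -addnS addnC leq_add2l.
have d_gt0 : 0 < n - r by lia.
have lt_dn : (n - r).+1 < n by lia.
apply: leq_trans (leq_bigmax_cond _ (fork_Acyclic d_gt0 lt_dn)).
have altD := alternating_in d_gt0 lt_dn.
have rk_alt := rk_alternating d_gt0 lt_dn.
rewrite subKn in rk_alt; last exact: ltnW.
apply: leq_trans (leq_bigmax_cond (alternating d_gt0 lt_dn) _).
  have := alternating_length d_gt0 lt_dn; rewrite subKn ?(ltnW lt_rn) //.
  by rewrite (sum_pred_split (ltnW lt_rn)) -addnS addnC leq_add2r.
by rewrite altD rk_alt eqxx.
Qed.

(** The contribution of the image points to [arc_length_excess] is 0 for r = 2,
so dropping it bounds the length of every map by the value for rank 2. *)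
Lemma lmax_AcyclicE n : 2 < n -> lmax_Acyclic n = lmax_Acyclic_rk n 2.
Proof.
move=> n_gt2; apply/eqP; rewrite eqn_leq; apply/andP; split; last first.
  apply/bigmax_leqP => D acD; apply: leq_trans (leq_bigmax_cond _ acD).
  apply/bigmax_leqP => f /andP[fD _].
  exact: (leq_bigmax_cond (F := arc_length D)).
rewrite lmax_Acyclic_rkE //; apply/bigmax_leqP => D.
rewrite inE => /andP[_ acD]; apply/bigmax_leqP => f fD.
apply: leq_trans (leq_addr _ _) (leq_trans (arc_length_excess acD fD) _).
by rewrite (sum_pred_split (ltnW n_gt2)) !big_ord_recl big_ord0.
Qed.

Import GRing.Theory Num.Theory.
Local Open Scope ring_scope.

Lemma sum_pred_rat (n r : nat) : (0 < r <= n)%N ->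
  (\sum_(r <= i < n) i.-1)%N%:R = (n%:R - r%:R) * (n%:R + r%:R - 3) / 2 :> rat.
Proof.
case/andP=> r_gt0; elim: n => [|n IHn]; first by case: r r_gt0.
rewrite leq_eqVlt => /predU1P[<-|lt_rn].
  by rewrite big_geq // subrr !mul0r.
have n_gt0 : (0 < n)%N by apply: leq_trans r_gt0 lt_rn.
rewrite big_nat_recr //= natrD IHn // -(prednK n_gt0) /=.
by rewrite -[n.-1.+2]addn2 -[n.-1.+1]addn1 !natrD; field.
Qed.

Theorem theorem3p1 (n : nat) (hn : (3 <= n)%N) :
  (forall r : nat, (2 <= r <= n - 1)%N ->
     (lmax_Acyclic_rk n r)%:R =
       (n%:R - r%:R) * (n%:R + r%:R - 3) / 2 + 1 :> rat)
  /\ lmax_Acyclic n = lmax_Acyclic_rk n 2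
  /\ (lmax_Acyclic_rk n 2)%:R = 1 / 2 * (n%:R ^+ 2 - 3 * n%:R + 4) :> rat.
Proof.
have rkE (r : nat) : (2 <= r <= n - 1)%N -> (lmax_Acyclic_rk n r)%:R =
    (n%:R - r%:R) * (n%:R + r%:R - 3) / 2 + 1 :> rat.
  move=> r_bounds; rewrite lmax_Acyclic_rkE; last by lia.
  by rewrite -addn1 natrD sum_pred_rat //; lia.
split=> //; split; first exact: lmax_AcyclicE.
by rewrite rkE; [field | lia].
Qed.
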